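(* For integers $k\ge 1$ and $n\ge 0$ put $$A_{k,n}=T_{k-1}+4^k(2n),\qquad B_{k,n}=P_k+4^k n .$$ Then: (i) for all $k\ge 1$, $n\ge 0$, the Collatz iterate of $A_{k,n}$ is $6n+1$, with exponent $\alpha=2k$, i.e. $(3A_{k,n}+1)/2^{2k}=6n+1$; (ii) for all $k\ge 1$, $n\ge 0$, the Collatz iterate of $B_{k,n}$ is $6n+5$, with exponent $\alpha=2k-1$, i.e. $(3B_{k,n}+1)/2^{2k-1}=6n+5$; (iii) every positive odd integer occurs exactly once among all the numbers $A_{k,n}$ and $B_{k,n}$ ($k\ge 1$, $n\ge 0$) taken together; (iv) for every $n\ge 0$, the set of all positive odd integers whose Collatz iterate is $6n+1$ is exactly $\{A_{k,n}: k\ge 1\}$, and the set of all positive odd integers whose Collatz iterate is $6n+5$ is exactly $\{B_{k,n}: k\ge 1\}$.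
   Context: For a positive odd integer $x$, its Collatz iterate is the odd integer $y=(3x+1)/2^{\alpha}$, where $\alpha$ is the (unique) positive integer making $y$ an odd integer. The integers $T_k$ ($k\ge 0$) are defined by $T_k=\sum_{i=0}^{k}4^i=(4^{k+1}-1)/3$, so $T_0=1$, $T_1=5$, $T_2=21$, and so on. The integers $P_k$ ($k\ge 1$) are defined by $P_1=3$ and $P_{k+1}=4P_k+1$, so $P_2=13$, $P_3=53$, $P_4=213$, and so on. *)

(* Defs.v *)
From mathcomp Require Import all_boot.

Set Implicit Arguments.
Unset Strict Implicit.
Unset Printing Implicit Defensive.

(* [a] is the exponent of the Collatz step from the positive odd integer [x].
   The divisibility condition makes the truncated division below exact. *)
Definition collatz_exponent (x a : nat) : Prop :=
  [/\ odd x, 0 < a, 2 ^ a %| 3 * x + 1 & odd ((3 * x + 1) %/ 2 ^ a)].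

(* "The Collatz iterate of the positive odd integer [x] is [y]", as a relation;
   it is the graph of a function on odd integers by [collatz_exponent_unique]
   and [collatz_iterate_unique] below. *)
Definition collatz_iterate (x y : nat) : Prop :=
  exists2 a, collatz_exponent x a & y = (3 * x + 1) %/ 2 ^ a.

Definition T_ (k : nat) : nat := \sum_(0 <= i < k.+1) 4 ^ i.

(* Only meaningful for [k >= 1]: [P_ 1 = 3]; the value at 0 is never used. *)
Definition P_ (k : nat) : nat := iter k.-1 (fun p => 4 * p + 1) 3.

Definition A_ (k n : nat) : nat := T_ k.-1 + 4 ^ k * (2 * n).

Definition B_ (k n : nat) : nat := P_ k + 4 ^ k * n.

(* The two families taken together, [inl (k, n)] indexing [A_ k n] and
   [inr (k, n)] indexing [B_ k n]: two positions with equal values remain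
   distinct occurrences. *)
Definition AB_value (p : nat * nat + nat * nat) : nat :=
  match p with inl (k, n) => A_ k n | inr (k, n) => B_ k n end.

Definition AB_row (p : nat * nat + nat * nat) : nat :=
  match p with inl (k, _) => k | inr (k, _) => k end.

Lemma T_closed k : T_ k = (4 ^ k.+1 - 1) %/ 3.
Proof.
rewrite subn1 predn_exp /= mulKn // /T_ big_mkord.
by apply: eq_bigr.
Qed.

Lemma P_1 : P_ 1 = 3. Proof. by []. Qed.

Lemma P_S k : 1 <= k -> P_ k.+1 = 4 * P_ k + 1.
Proof. by case: k. Qed.

Lemma collatz_exponent_logn x a :
  collatz_exponent x a -> a = logn 2 (3 * x + 1).
Proof.
case=> _ _ /divnK {2}<- oy.
rewrite lognM ?expn_gt0 // ?odd_gt0 // pfactorK // lognE.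
by rewrite dvdn2 oy /= andbF.
Qed.

Lemma collatz_exponent_unique x : odd x -> exists! a, collatz_exponent x a.
Proof.
move=> ox; exists (logn 2 (3 * x + 1)); split; last first.
  by move=> a /collatz_exponent_logn.
have x0 : 0 < 3 * x + 1 by rewrite addn1.
split=> //; last 2 first.
- exact: pfactor_dvdnn.
- have [//|m cm e] := @pfactor_coprime 2 (3 * x + 1) isT.
  by rewrite {1}e mulnK ?expn_gt0 // -coprime2n.
by rewrite logn_gt0 mem_primes x0 /= dvdn2 oddD oddM ox.
Qed.

Lemma collatz_iterate_unique x : odd x -> exists! y, collatz_iterate x y.
Proof.
move=> /collatz_exponent_unique[a [ea ua]].
exists ((3 * x + 1) %/ 2 ^ a); split; first by exists a.
by move=> _ [b /ua <- ->].
Qed.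

(* Main.v *)
Require Import Defs.
From mathcomp Require Import all_boot.
From mathcomp Require Import zify.

Set Implicit Arguments.
Unset Strict Implicit.

(** A Collatz step from [x] to [y] with exponent [a] is an equation
    [3 * x + 1 = 2 ^ a * y] with [y] odd and [a] positive ([collatz_stepP]).

    The entries of the two families are the solutions of such equations:
    [3 * A_ k n + 1 = 2 ^ (2 * k) * (6 * n + 1)] and
    [3 * B_ k n + 1 = 2 ^ (2 * k - 1) * (6 * n + 5)] ([AB_equation]).
    This gives the iterates of the entries, and it gives uniqueness of the
    occurrences: [x] determines [a] and [y], and the pair [(a, y)] determines
    the family (parity of [a]), the row and the column ([AB_step_inj]).

    For existence, reduce [3 * x + 1 = 2 ^ a * y] modulo 3.  Since 2 is -1
    modulo 3, the odd number [y] is 1 modulo 6 when [a] is even and 5 modulo 6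
    when [a] is odd, so [(a, y)] is the step of some entry, and that entry
    satisfies the same equation as [x] ([AB_value_surj]).  The fibres of the
    Collatz map are then read off from the positions of their elements. *)

Lemma collatz_stepP x a y :
  (collatz_exponent x a /\ y = (3 * x + 1) %/ 2 ^ a) <->
  [/\ 0 < a, odd y & 3 * x + 1 = 2 ^ a * y].
Proof.
split=> [[[ox a0 dv oy] ->]|[a0 oy e]].
  by split=> //; rewrite [RHS]mulnC divnK.
have eq_y : (3 * x + 1) %/ 2 ^ a = y by rewrite e mulKn ?expn_gt0.
split; last by rewrite eq_y.
split=> //; [|by rewrite e dvdn_mulr|by rewrite eq_y].
(* [x] is odd because [a] is positive, which makes [3 * x + 1] even. *)
have : odd (3 * x + 1) = false by rewrite e oddM oddX eqn0Ngt a0.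
by rewrite oddD oddM /= addbT => /negbFE.
Qed.

Lemma odd_pow2_mod3 a : 2 ^ a %% 3 = if odd a then 2 else 1.
Proof. by elim: a => // a IH; rewrite expnS -modnMmr IH /=; case: (odd a). Qed.

Definition AB_exponent (p : nat * nat + nat * nat) : nat :=
  match p with inl (k, _) => 2 * k | inr (k, _) => 2 * k - 1 end.

Definition AB_iterate (p : nat * nat + nat * nat) : nat :=
  match p with inl (_, n) => 6 * n + 1 | inr (_, n) => 6 * n + 5 end.

Lemma T_equation k : 3 * T_ k + 1 = 4 ^ k.+1.
Proof.
rewrite /T_; elim: k => [|k IH]; first by rewrite big_nat1.
by rewrite big_nat_recr //= mulnDr addnAC IH (expnS 4 k.+1); lia.
Qed.

Lemma P_equation k : 3 * P_ k.+1 + 1 = 10 * 4 ^ k.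
Proof. by elim: k => // k IH; rewrite P_S // expnS; lia. Qed.

Lemma AB_equation p : 1 <= AB_row p ->
  3 * AB_value p + 1 = 2 ^ AB_exponent p * AB_iterate p.
Proof.
case: p => [] [[|k] n] //= _.
  by rewrite /A_ /= expnM -[2 ^ 2]/4; have := T_equation k; lia.
have -> : 2 * k.+1 - 1 = (2 * k).+1 by lia.
rewrite /B_ (expnS 2) (expnM 2) -[2 ^ 2]/4 (expnS 4).
by have := P_equation k; lia.
Qed.

Lemma AB_step p : 1 <= AB_row p ->
  collatz_exponent (AB_value p) (AB_exponent p) /\
  AB_iterate p = (3 * AB_value p + 1) %/ 2 ^ AB_exponent p.
Proof.
move=> p0; apply/collatz_stepP; split; last exact: AB_equation.
  by case: p p0 => [] [k n] /=; lia.
by case: p {p0} => [] [k n] /=; rewrite oddD oddM.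
Qed.

(** The parity of the exponent tells the family. *)
Lemma AB_step_inj p q : 1 <= AB_row p -> 1 <= AB_row q ->
  AB_exponent p = AB_exponent q -> AB_iterate p = AB_iterate q -> p = q.
Proof.
case: p => [] [k n]; case: q => [] [l m] /= k0 l0 ea ey; try lia.
  by congr (inl (_, _)); lia.
by congr (inr (_, _)); lia.
Qed.

(** Modulo 3, the equation forces [y] to be congruent to [(-1) ^ a]. *)
Lemma AB_step_surj x a y : 0 < a -> odd y -> 3 * x + 1 = 2 ^ a * y ->
  exists p, [/\ 1 <= AB_row p, AB_exponent p = a & AB_iterate p = y].
Proof.
move=> a0 oy e.
have : (2 ^ a %% 3) * y %% 3 = 1 by rewrite modnMml -e mulnC modnMDl.
rewrite odd_pow2_mod3; case: ifP => oa y3.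
  by exists (inr (a./2.+1, y %/ 6)); split=> //=; lia.
by exists (inl (a./2, y %/ 6)); split=> /=; lia.
Qed.

Lemma AB_value_surj x : odd x -> exists2 p, 1 <= AB_row p & AB_value p = x.
Proof.
move=> /collatz_exponent_unique[a [ea _]].
have [a0 oy e] := (@collatz_stepP _ _ _).1 (conj ea erefl).
have [p [p0 pa py]] := AB_step_surj a0 oy e.
by exists p => //; have := AB_equation p0; rewrite pa py -e; lia.
Qed.

Lemma AB_collatz_iterate p : 1 <= AB_row p ->
  collatz_iterate (AB_value p) (AB_iterate p).
Proof. by move=> /AB_step[ea ey]; exists (AB_exponent p). Qed.

Lemma AB_iterate_unique p y : 1 <= AB_row p ->
  collatz_iterate (AB_value p) y -> y = AB_iterate p.
Proof.
move=> /AB_step[ea ->] [b eb ->].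
by rewrite (collatz_exponent_logn ea) (collatz_exponent_logn eb).
Qed.

Lemma AB_value_inj p q : 1 <= AB_row p -> 1 <= AB_row q ->
  AB_value p = AB_value q -> p = q.
Proof.
move=> p0 q0 e; apply: AB_step_inj => //.
  have [+ _] := AB_step p0; have [+ _] := AB_step q0; rewrite e.
  by move=> /collatz_exponent_logn-> /collatz_exponent_logn->.
by apply: AB_iterate_unique => //; rewrite -e; exact: AB_collatz_iterate.
Qed.

Lemma collatz_fibre x y :
  collatz_iterate x y <->
  exists p, [/\ 1 <= AB_row p, AB_value p = x & AB_iterate p = y].
Proof.
split=> [xy|[p [p0 <- <-]]]; last exact: AB_collatz_iterate.
have [a [ox _ _ _] _] := xy.
have [p p0 px] := AB_value_surj ox.
by exists p; split=> //; rewrite -px in xy; rewrite (AB_iterate_unique p0 xy).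
Qed.

Theorem mainTheorem1 :
  [/\ (* (i) *)
      forall k n : nat, 1 <= k ->
        [/\ collatz_iterate (A_ k n) (6 * n + 1),
            collatz_exponent (A_ k n) (2 * k)
          & (3 * A_ k n + 1) %/ 2 ^ (2 * k) = 6 * n + 1],
      (* (ii) *)
      forall k n : nat, 1 <= k ->
        [/\ collatz_iterate (B_ k n) (6 * n + 5),
            collatz_exponent (B_ k n) (2 * k - 1)
          & (3 * B_ k n + 1) %/ 2 ^ (2 * k - 1) = 6 * n + 5],
      (* (iii) *)
      forall x : nat, odd x ->
        exists! p : nat * nat + nat * nat, 1 <= AB_row p /\ AB_value p = x
    & (* (iv) *)
      forall n : nat,
        (forall x : nat, collatz_iterate x (6 * n + 1) <->
           exists k : nat, 1 <= k /\ x = A_ k n) /\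
        (forall x : nat, collatz_iterate x (6 * n + 5) <->
           exists k : nat, 1 <= k /\ x = B_ k n)].
Proof.
split=> [k n k0|k n k0|x /AB_value_surj[p p0 px]|n].
- have [ea ey] := @AB_step (inl (k, n)) k0.
  by split=> //; exact: (@AB_collatz_iterate (inl (k, n)) k0).
- have [ea ey] := @AB_step (inr (k, n)) k0.
  by split=> //; exact: (@AB_collatz_iterate (inr (k, n)) k0).
- by exists p; split=> // q [q0 qx]; apply: AB_value_inj; rewrite // px.
(* The residue of the iterate modulo 6 tells the family, its quotient [n]. *)
- split=> x; rewrite collatz_fibre; split.
  + case=> [] [] [] k m [] /= k0 <- ey; last lia.
    by exists k; split=> //; congr (A_ _ _); lia.
  + by case=> k [k0 ->]; exists (inl (k, n)).
  + case=> [] [] [] k m [] /= k0 <- ey; first lia.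
    by exists k; split=> //; congr (B_ _ _); lia.
  + by case=> k [k0 ->]; exists (inr (k, n)).
Qed.
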